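(* Let $\gamma: I\to\mathbb{E}_1^3$ be a unit speed spacelike curve on a timelike surface $M\subset\mathbb{E}_1^3$, with geodesic curvature $\kappa_g$, normal curvature $\kappa_n$ and geodesic torsion $\tau_g$. Then $\gamma$ is a relatively normal-slant helix if and only if any one of the following two functions is a constant function: (i) $\coth\delta=\lambda(s)=\pm\left[\dfrac{\kappa_g^2}{(\kappa_g^2+\tau_g^2)^{3/2}}\left(\dfrac{\tau_g}{\kappa_g}\right)'-\dfrac{\kappa_n}{(\kappa_g^2+\tau_g^2)^{1/2}}\right]$, (ii) $\tanh\zeta=\rho(s)=\mp\left[\dfrac{\kappa_g^2}{(\kappa_g^2+\tau_g^2)^{3/2}}\left(\dfrac{\tau_g}{\kappa_g}\right)'-\dfrac{\kappa_n}{(\kappa_g^2+\tau_g^2)^{1/2}}\right]$.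
   Context: $\mathbb{E}_1^3$ is $\mathbb{R}^3$ with $\langle x,y\rangle=-x_1y_1+x_2y_2+x_3y_3$. A vector $x$ is spacelike if $\langle x,x\rangle>0$ or $x=0$, timelike if $\langle x,x\rangle<0$, lightlike if $\langle x,x\rangle=0$ (and $x\neq0$). A curve is spacelike (timelike) if its velocity is; a surface is spacelike (timelike) if its unit normal is timelike (spacelike). Everything is smooth, $I$ is an open interval, $s$ is arc length and $'=d/ds$. Darboux frame: for $\gamma$ a unit speed spacelike curve on a timelike surface $M$ with unit normal $N$ along $\gamma$, put $T=\gamma'$, $B=N\times T$ (Lorentzian cross product $x\times y=(x_2y_3-x_3y_2,\,x_1y_3-x_3y_1,\,x_2y_1-x_1y_2)$). Then $\langle T,T\rangle=\langle N,N\rangle=1$, $\langle B,B\rangle=-1$, the three are mutually orthogonal, and $\kappa_g,\kappa_n,\tau_g$ are defined by $$T'=\kappa_gB-\kappa_nN,\quad B'=\kappa_gT+\tau_gN,\quad N'=\kappa_nT+\tau_gB.$$ The curve has curvature $\kappa>0$ and its principal normal $n$ (with $T'=\kappa n$) is spacelike: $\langle n,n\rangle=1$. Relatively normal-slant helix: $B$ makes a constant angle with a fixed direction, i.e. there is a constant unit vector $d$ ($\langle d,d\rangle=\pm1$), called the axis, with $\langle B,d\rangle$ constant along $\gamma$. In (i), (ii) the sign $\pm$ or $\mp$ is a fixed choice and the constant value of the function is written as $\coth\delta$, $\tanh\zeta$ respectively, where $\delta,\zeta$ are the constant angles: $\langle B,d\rangle=-\cosh\delta$ for $d$ timelike (in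 the same time-cone as $B$) in (i); $\langle B,d\rangle=\sinh\zeta$ for $d$ spacelike in (ii). It is assumed that $\kappa_g$ vanishes nowhere on $I$, so that the expressions are defined. *)

(* Defs.v *)
From HB Require Import structures.
From mathcomp Require Export all_boot all_order all_algebra.
From mathcomp Require Export all_classical all_reals all_analysis.

Set Implicit Arguments.
Unset Strict Implicit.
Unset Printing Implicit Defensive.

Export Order.TTheory GRing.Theory Num.Theory.
Export numFieldNormedType.Exports.

Open Scope ring_scope.
Open Scope classical_set_scope.

Section Hyperbolic.
Context {R : realType}.

Definition cosh (x : R) : R := (expR x + expR (- x)) / 2.
Definition sinh (x : R) : R := (expR x - expR (- x)) / 2.
Definition tanh (x : R) : R := sinh x / cosh x.
(* Meaningful for x != 0 only: coth 0 = 0 because of division by zero. *)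
Definition coth (x : R) : R := cosh x / sinh x.

End Hyperbolic.

Section Minkowski.
Context {R : realType}.

Implicit Types x y : 'rV[R]_3.

Definition mink x y : R := - (x 0 0 * y 0 0) + x 0 1 * y 0 1 + x 0 2 * y 0 2.

Definition spacelike x : Prop := 0 < mink x x \/ x = 0.
Definition timelike x : Prop := mink x x < 0.

Definition unit_vector x : Prop := mink x x = 1 \/ mink x x = -1.

(* For timelike x and y: y lies in the same time-cone as x. *)
Definition same_timecone x y : Prop := mink x y < 0.

Definition lcross x y : 'rV[R]_3 :=
  \row_(i < 3) [:: x 0 1 * y 0 2 - x 0 2 * y 0 1;
                   x 0 0 * y 0 2 - x 0 2 * y 0 0;
                   x 0 1 * y 0 0 - x 0 0 * y 0 1]`_i.

End Minkowski.

Section Smoothness.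
Context {R : realType} {V W : normedModType R}.

(* Class C^k on an open set U. When V is finite-dimensional, f is C^(k+1) iff
   all its directional derivatives exist on U and are C^k there. *)
Fixpoint Ck_on (k : nat) (U : set V) (f : V -> W) : Prop :=
  (forall x, U x -> {for x, continuous f}) /\
  (if k is k'.+1 then
     forall v : V, (forall x, U x -> derivable f x v) /\ Ck_on k' U ('D_v f)
   else True).

Definition smooth_on (U : set V) (f : V -> W) : Prop :=
  forall k, Ck_on k U f.

End Smoothness.

Section Surfaces.
Context {R : realType}.

(* X : U -> M `&` O is a local parametrization of M: a smooth immersion that is
   a homeomorphism onto the open piece M `&` O of M, with inverse Y. *)
Definition local_param (M : set 'rV[R]_3) (U : set 'rV[R]_2)
    (O : set 'rV[R]_3) (X : 'rV[R]_2 -> 'rV[R]_3) : Prop :=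
  [/\ smooth_on U X,
      forall u, U u -> injective ('d X u),
      X @` U = M `&` O &
      exists2 Y : 'rV[R]_3 -> 'rV[R]_2,
        {within M `&` O, continuous Y} & forall u, U u -> Y (X u) = u].

Definition regular_surface (M : set 'rV[R]_3) : Prop :=
  forall p, M p -> exists U O X,
    [/\ open U, open O, O p & local_param M U O X].

Definition tangent_to (M : set 'rV[R]_3) (p w : 'rV[R]_3) : Prop :=
  exists (e : R) (c : R -> 'rV[R]_3),
    [/\ 0 < e, smooth_on [set` `]- e, e[] c,
        forall t, t \in `]- e, e[ -> M (c t), c 0 = p & c^`() 0 = w].

Definition unit_normal (M : set 'rV[R]_3) (p n : 'rV[R]_3) : Prop :=
  unit_vector n /\ forall w, tangent_to M p w -> mink n w = 0.

(* The existence clause rules out points whose tangent plane is degenerate: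
   there the normal direction is lightlike and cannot be normalized. *)
Definition timelike_surface (M : set 'rV[R]_3) : Prop :=
  regular_surface M /\
  forall p, M p ->
    (exists n, unit_normal M p n) /\
    (forall n, unit_normal M p n -> spacelike n).

End Surfaces.

Section DarbouxFrame.
Context {R : realType}.
Variable I : set R.

Definition open_interval : Prop := open I /\ is_interval I.

Definition unit_speed_spacelike_curve (gamma : R -> 'rV[R]_3) : Prop :=
  smooth_on I gamma /\
  forall s, I s -> spacelike (gamma^`()%classic s) /\ unit_vector (gamma^`()%classic s).

Definition unit_normal_along (M : set 'rV[R]_3)
    (gamma N : R -> 'rV[R]_3) : Prop :=
  smooth_on I N /\ forall s, I s -> unit_normal M (gamma s) (N s).

Definition darbouxB (gamma N : R -> 'rV[R]_3) (s : R) : 'rV[R]_3 :=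
  lcross (N s) (gamma^`()%classic s).

Definition darboux_curvatures (gamma N : R -> 'rV[R]_3)
    (kg kn tg : R -> R) : Prop :=
  let T := gamma^`() in
  let B := darbouxB gamma N in
  forall s, I s ->
    [/\ T^`() s = kg s *: B s - kn s *: N s,
        B^`() s = kg s *: T s + tg s *: N s &
        N^`() s = kn s *: T s + tg s *: B s].

Definition spacelike_principal_normal (gamma : R -> 'rV[R]_3)
    (kappa : R -> R) (n : R -> 'rV[R]_3) : Prop :=
  forall s, I s ->
    [/\ gamma^`()^`() s = kappa s *: n s, 0 < kappa s & mink (n s) (n s) = 1].

Definition relatively_normal_slant_helix (gamma N : R -> 'rV[R]_3) : Prop :=
  exists2 d : 'rV[R]_3, unit_vector d &
    exists c : R, forall s, I s -> mink (darbouxB gamma N s) d = c.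

(* d is a timelike axis making the constant angle delta with B. *)
Definition timelike_axis (gamma N : R -> 'rV[R]_3) (d : 'rV[R]_3)
    (delta : R) : Prop :=
  [/\ unit_vector d, timelike d &
      forall s, I s -> same_timecone (darbouxB gamma N s) d /\
                       mink (darbouxB gamma N s) d = - cosh delta].

(* d is a spacelike axis making the constant angle zeta with B. *)
Definition spacelike_axis (gamma N : R -> 'rV[R]_3) (d : 'rV[R]_3)
    (zeta : R) : Prop :=
  [/\ unit_vector d, spacelike d &
      forall s, I s -> mink (darbouxB gamma N s) d = sinh zeta].

End DarbouxFrame.

Section Invariants.
Context {R : realType}.
Variables kg kn tg : R -> R.

Definition slant_invariant (s : R) : R :=
  kg s ^+ 2 / (kg s ^+ 2 + tg s ^+ 2) `^ (3 / 2)
    * (fun t => tg t / kg t)^`()%classic s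
  - kn s / (kg s ^+ 2 + tg s ^+ 2) `^ (1 / 2).

(* The boolean b is the choice of sign: + for false, - for true in lambda,
   and the opposite in rho. *)
Definition lambda (b : bool) (s : R) : R := (-1) ^+ b * slant_invariant s.
Definition rho (b : bool) (s : R) : R := - ((-1) ^+ b * slant_invariant s).

End Invariants.

(* Main.v *)
Require Import Defs.
From mathcomp Require Import ring lra.

(* Write W = sqrt (kg^2 + tg^2), f = kg / W, g = tg / W and L for the slant
   invariant. Then f^2 + g^2 = 1, and (f, g) rotates: f' = - g (W L + kn) and
   g' = f (W L + kn). If <B, d> = c, differentiating gives
   f <T, d> + g <N, d> = 0, so (<T, d>, <N, d>) = u (- g, f) for a function u;
   its derivative vanishes, so u is a constant sigma with
   sigma^2 = <d, d> + c^2, and differentiating the relation once more gives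
   c = - sigma L. Conversely, if c = - sigma L with sigma constant, then
   - sigma g T + sigma f N - c B has zero derivative and is the axis. The cases
   <d, d> = -1, c = - cosh delta and <d, d> = 1, c = sinh zeta are (i) and
   (ii). *)

Set Implicit Arguments.
Unset Strict Implicit.
Unset Printing Implicit Defensive.

(** * Differential calculus of real functions *)

Section RealDerivatives.
Context {R : realType}.
Implicit Types (f g : R -> R) (I : set R).

Lemma is_derive_mul f g (x a b : R) :
  is_derive x (1 : R) f a -> is_derive x (1 : R) g b ->
  is_derive x (1 : R) (fun t => f t * g t) (a * g x + f x * b).
Proof.
move=> df dg; apply: (is_derive_eq (is_deriveM df dg)).
by rewrite /GRing.scale/=; ring.
Qed.

Lemma is_derive_div f g (x a b : R) : g x != 0 ->
  is_derive x (1 : R) f a -> is_derive x (1 : R) g b ->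
  is_derive x (1 : R) (fun t => f t / g t) ((a * g x - f x * b) / g x ^+ 2).
Proof.
move=> gx0 df dg; apply: (is_derive_eq (is_derive_mul df (is_deriveV gx0 dg))).
by rewrite /GRing.scale/=; field.
Qed.

Lemma is_derive_norm2 f g (x a b : R) : f x != 0 ->
  is_derive x (1 : R) f a -> is_derive x (1 : R) g b ->
  is_derive x (1 : R) (fun t => Num.sqrt (f t ^+ 2 + g t ^+ 2))
    ((f x * a + g x * b) / Num.sqrt (f x ^+ 2 + g x ^+ 2)).
Proof.
move=> fx0 df dg.
have h0 : 0 < f x ^+ 2 + g x ^+ 2.
  by rewrite ltr_wpDr ?sqr_ge0// exprn_even_gt0.
have dfg : is_derive x (1 : R) (fun t => f t ^+ 2 + g t ^+ 2) _ :=
  is_deriveD (is_derive_mul df df) (is_derive_mul dg dg).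
apply: (is_derive_eq (is_derive1_comp
  (g := fun t => f t ^+ 2 + g t ^+ 2) (is_derive1_sqrt h0) dfg)).
have : Num.sqrt (f x ^+ 2 + g x ^+ 2) != 0 by rewrite sqrtr_eq0 -ltNge.
by move=> ?; field.
Qed.

Lemma derive0_constant I f : is_interval I ->
  (forall s, I s -> is_derive s (1 : R) f 0) ->
  forall s t, I s -> I t -> f s = f t.
Proof.
move=> iI df; suff le s t : s <= t -> I s -> I t -> f s = f t.
  move=> s t Is It; have [/le->//|/ltW/le ->//] := leP s t.
move=> st Is It.
have Iz z : z \in `[s, t]%R -> I z.
  by rewrite in_itv/=; exact: iI.
have cf : {within `[s, t], continuous f}.
  by apply: derivable_within_continuous => z /Iz/df [].
have df0 z : z \in `]s, t[%R -> is_derive z 1 f (cst 0 z).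
  by move=> zst; apply/df/Iz; exact: subset_itv_oo_cc.
have [x _ /esym/eqP] := MVT_segment st df0 cf.
by rewrite mul0r eq_sym subr_eq0 => /eqP.
Qed.

(** Allows an identity known only on [I] to be differentiated: as [I] is open, it holds near each of
    its points. *)
Lemma locally_constant_derive0 I f (c s l : R) : open I ->
  (forall t, I t -> f t = c) -> I s -> is_derive s (1 : R) f l -> l = 0.
Proof.
move=> oI fc Is [_ <-].
rewrite (near_eq_derive (g := cst c)) ?derive_cst//.
by near=> t; apply: fc; near: t; exact: open_nbhs_nbhs.
Unshelve. all: by end_near. Qed.

End RealDerivatives.

(** * The half-integer powers in [slant_invariant] as powers of a square root *)

Section Powers.
Context {R : realType}.
Lemma powR_half (a : R) : 0 <= a -> a `^ (1 / 2) = Num.sqrt a.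
Proof. by move=> a0; rewrite div1r powR12_sqrt. Qed.

Lemma powR_3half (a : R) : 0 <= a -> a `^ (3 / 2) = Num.sqrt a ^+ 3.
Proof.
by move=> a0; rewrite mulrC powRrM powR12_sqrt// powR_mulrn// sqrtr_ge0.
Qed.
End Powers.

(** * Derivatives of vector functions and of their Lorentzian products *)

Section VectorDerivatives.
Context {R : realType}.
Implicit Types (F G : R -> 'rV[R]_3) (u v : 'rV[R]_3).

Lemma is_derive_coord F s v i : is_derive s (1 : R) F v ->
  is_derive s (1 : R) (fun t => F t 0 i) (v 0 i).
Proof.
move=> [dF <-]; split; first exact/(derivable_mxP F s 1).1.
by rewrite derive_mx// mxE.
Qed.

Lemma is_derive_mink F G s u v :
  is_derive s (1 : R) F u -> is_derive s (1 : R) G v ->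
  is_derive s (1 : R) (fun t => mink (F t) (G t)) (mink u (G s) + mink (F s) v).
Proof.
move=> dF dG.
have dFG i := is_derive_mul (is_derive_coord i dF) (is_derive_coord i dG).
apply: (is_derive_eq (is_deriveD (is_deriveD (is_deriveN (dFG 0)) (dFG 1))
  (dFG 2))).
by rewrite /mink; ring.
Qed.

Lemma is_derive_minkl F s u v : is_derive s (1 : R) F u ->
  is_derive s (1 : R) (fun t => mink (F t) v) (mink u v).
Proof.
move=> dF; apply: (is_derive_eq (is_derive_mink dF (is_derive_cst v s 1))).
by rewrite /mink !mxE; ring.
Qed.

Lemma derivable_lcross F G s : derivable F s 1 -> derivable G s 1 ->
  derivable (fun t => lcross (F t) (G t)) s 1.
Proof.
move=> /derivableP dF /derivableP dG.
have dFG i j := is_derive_mul (is_derive_coord i dF) (is_derive_coord j dG).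
have d i j k l := @ex_derive _ _ _ _ _ _ _ (is_deriveB (dFG i j) (dFG k l)).
apply/derivable_mxP => i j.
under eq_fun do rewrite mxE.
by case: j => -[|[|[|//]]] ? /=; exact: d.
Qed.

End VectorDerivatives.

(** * Algebra of the Lorentzian scalar and cross products *)

Section MinkowskiAlgebra.
Context {R : realType}.
Implicit Types x y z : 'rV[R]_3.

Lemma minkC x y : mink x y = mink y x.
Proof. by rewrite /mink; ring. Qed.

Lemma minkDl x y z : mink (x + y) z = mink x z + mink y z.
Proof. by rewrite /mink !mxE; ring. Qed.

Lemma minkNl x y : mink (- x) y = - mink x y.
Proof. by rewrite /mink !mxE; ring. Qed.

Lemma minkZl a x y : mink (a *: x) y = a * mink x y.
Proof. by rewrite /mink !mxE; ring. Qed.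

Lemma minkDr x y z : mink z (x + y) = mink z x + mink z y.
Proof. by rewrite !(minkC z) minkDl. Qed.

Lemma minkNr x y : mink y (- x) = - mink y x.
Proof. by rewrite !(minkC y) minkNl. Qed.

Lemma minkZr a x y : mink y (a *: x) = a * mink y x.
Proof. by rewrite !(minkC y) minkZl. Qed.

Definition mink_linear := (minkDl, minkNl, minkZl, minkDr, minkNr, minkZr).

Lemma lcross_orthl x y : mink (lcross x y) x = 0.
Proof. by rewrite /mink !mxE/=; ring. Qed.

Lemma lcross_orthr x y : mink (lcross x y) y = 0.
Proof. by rewrite /mink !mxE/=; ring. Qed.

(* The square of the triple product is minus the Gram determinant. *)
Lemma mink_lcross_sq x y z : mink (lcross x y) z ^+ 2 =
  - (mink x x * (mink y y * mink z z - mink y z ^+ 2)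
     - mink x y * (mink x y * mink z z - mink y z * mink x z)
     + mink x z * (mink x y * mink y z - mink y y * mink x z)).
Proof. by rewrite /mink !mxE/=; ring. Qed.

(** Lagrange's identity, with the sign reversed by the signature: the cross product of two
    orthonormal spacelike vectors is unit timelike. *)
Lemma lcross_lcross_norm x y :
  mink (lcross x y) (lcross x y) = mink x y ^+ 2 - mink x x * mink y y.
Proof. by rewrite /mink !mxE/=; ring. Qed.

End MinkowskiAlgebra.

(** * Smooth curves, and their velocities as tangent vectors of a surface *)

Section Smooth.
Context {R : realType}.
Implicit Types (f : R -> 'rV[R]_3) (U V : set R).

Lemma derive1_fun f : f^`()%classic = 'D_1 f.
Proof. by apply/funext => s; rewrite derive1E. Qed.

Lemma smooth_derivable U f s : smooth_on U f -> U s -> derivable f s 1.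
Proof. by move=> /(_ 1%N) [_ /(_ 1)[+ _]] => /[apply]. Qed.

Lemma smooth_derive1 U f : smooth_on U f -> smooth_on U f^`()%classic.
Proof. by rewrite derive1_fun => sf k; have [_ /(_ 1)[_]] := sf k.+1. Qed.

Lemma derive_translate f a v t :
  'D_v (fun t => f (a + t)) t = 'D_v f (a + t).
Proof.
rewrite /derive.
by under eq_fun do rewrite /= addrCA.
Qed.

Lemma derivable_translate f a t v :
  derivable f (a + t) v -> derivable (fun t => f (a + t)) t v.
Proof.
rewrite /derivable.
by under eq_fun do rewrite /= addrCA.
Qed.

(** Needed because [tangent_to] asks for a curve on an interval centred at 0, which is obtained by
    shifting the parameter. *)
Lemma smooth_translate U V f a : (forall t, V t -> U (a + t)) ->
  smooth_on U f -> smooth_on V (fun t => f (a + t)).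
Proof.
move=> UV sf k.
have ca t : {for t, continuous (fun t : R => a + t)}.
  by apply: cvgD; [exact: cvg_cst | exact: cvg_id].
(* The induction generalizes [f], since its hypothesis is applied to the derivative ['D_v f]. *)
elim: k f {sf}(sf k) => [|k IH] f [cf df].
  split=> // t /UV/cf cft.
  exact: (@continuous_comp _ _ _ (fun t : R => a + t) f _ (ca t) cft).
split=> [t /UV/cf cft|v].
  exact: (@continuous_comp _ _ _ (fun t : R => a + t) f _ (ca t) cft).
have [dfv Cfv] := df v; split=> [t /UV/dfv|]; first exact: derivable_translate.
by under eq_fun do rewrite derive_translate; exact: IH Cfv.
Qed.

Lemma tangent_velocity I (M : set 'rV[R]_3) f s : open I -> smooth_on I f ->
  (forall t, I t -> M (f t)) -> I s -> tangent_to M (f s) (f^`()%classic s).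
Proof.
move=> oI sf fM Is.
have /nbhs_ballP[e /= e0 eI] : nbhs s I by exact: open_nbhs_nbhs.
have sI t : t \in `]- e, e[%R -> I (s + t).
  rewrite in_itv/= -ltr_norml => te; apply: eI.
  by rewrite /ball/= opprD addrA subrr sub0r normrN.
exists e, (fun t => f (s + t)); split=> //.
- by apply: (smooth_translate (U := I)) sf => t /=; rewrite inE; exact: sI.
- by move=> t; rewrite inE => /sI/fM.
- by rewrite addr0.
- by rewrite derive1E derive_translate addr0 -derive1E.
Qed.

End Smooth.

(** * The axis equation in an abstract frame satisfying the Darboux equations *)

Section SlantAxis.
Context {R : realType} (I : set R) (T B N : R -> 'rV[R]_3) (kg kn tg : R -> R).
Context (oI : open I) (iI : is_interval I).
Context (BE : forall s, I s -> B s = lcross (N s) (T s)).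
Context (TT : forall s, I s -> mink (T s) (T s) = 1).
Context (NN : forall s, I s -> mink (N s) (N s) = 1).
Context (NT : forall s, I s -> mink (N s) (T s) = 0).
Context (dT : forall s, I s ->
  is_derive s (1 : R) T (kg s *: B s - kn s *: N s)).
Context (dB : forall s, I s ->
  is_derive s (1 : R) B (kg s *: T s + tg s *: N s)).
Context (dN : forall s, I s ->
  is_derive s (1 : R) N (kn s *: T s + tg s *: B s)).
Context (kg0 : forall s, I s -> kg s != 0).
Context (dkg : forall s, I s -> derivable kg s 1).
Context (dtg : forall s, I s -> derivable tg s 1).

Let W s := Num.sqrt (kg s ^+ 2 + tg s ^+ 2).
Let f s := kg s / W s.
Let g s := tg s / W s.
Let L := slant_invariant kg kn tg.

Let W2 s : W s ^+ 2 = kg s ^+ 2 + tg s ^+ 2.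
Proof. by rewrite sqr_sqrtr// addr_ge0 ?sqr_ge0. Qed.

Let W0 s : I s -> W s != 0.
Proof.
move=> Is; rewrite sqrtr_eq0 -ltNge ltr_wpDr ?sqr_ge0//.
by rewrite exprn_even_gt0/= ?kg0.
Qed.

Let fE s : I s -> kg s = W s * f s.
Proof. by move=> /W0 ?; rewrite mulrC divfK. Qed.

Let gE s : I s -> tg s = W s * g s.
Proof. by move=> /W0 ?; rewrite mulrC divfK. Qed.

Let fg1 s : I s -> f s ^+ 2 + g s ^+ 2 = 1.
Proof.
by move=> /W0 ?; rewrite !expr_div_n -mulrDl -W2 divff// expf_neq0.
Qed.

(** The quotient rule for [tg / kg] cancels the factor [kg ^+ 2] of the invariant. The right-hand
    side is the derivative of the polar angle of [(kg, tg)], that is, the rotation speed of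
    [(f, g)]. *)
Let slantE s : I s -> W s * L s + kn s =
  ('D_1 tg s * kg s - tg s * 'D_1 kg s) / W s ^+ 2.
Proof.
move=> Is; have W0s := W0 Is; have kg0s := kg0 Is.
have dkgs := derivableP (dkg Is); have dtgs := derivableP (dtg Is).
have [_ dr] := is_derive_div kg0s dtgs dkgs.
rewrite /L /slant_invariant derive1E dr.
rewrite powR_half ?powR_3half ?addr_ge0 ?sqr_ge0// -/(W s).
by field; rewrite W0s.
Qed.

Let df s : I s -> is_derive s (1 : R) f (- g s * (W s * L s + kn s)).
Proof.
move=> Is; have W0s := W0 Is; have kg0s := kg0 Is; rewrite slantE//.
have dkgs := derivableP (dkg Is); have dtgs := derivableP (dtg Is).
have dW := is_derive_norm2 kg0s dkgs dtgs.
apply: (is_derive_eq (is_derive_div W0s dkgs dW)).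
rewrite -/(W s) /g; apply/eqP; rewrite -subr_eq0.
(* The two sides differ by a multiple of [W ^+ 2 - kg ^+ 2 - tg ^+ 2], which [W2] makes zero;
   isolating it leaves a pure field identity. *)
rewrite (_ : _ - _ =
  'D_1 kg s * (W s ^+ 2 - kg s ^+ 2 - tg s ^+ 2) / W s ^+ 3); last by field.
by apply/eqP; rewrite W2; ring.
Qed.

Let dg s : I s -> is_derive s (1 : R) g (f s * (W s * L s + kn s)).
Proof.
move=> Is; have W0s := W0 Is; have kg0s := kg0 Is; rewrite slantE//.
have dkgs := derivableP (dkg Is); have dtgs := derivableP (dtg Is).
have dW := is_derive_norm2 kg0s dkgs dtgs.
apply: (is_derive_eq (is_derive_div W0s dtgs dW)).
rewrite -/(W s) /f; apply/eqP; rewrite -subr_eq0.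
rewrite (_ : _ - _ =
  'D_1 tg s * (W s ^+ 2 - kg s ^+ 2 - tg s ^+ 2) / W s ^+ 3); last by field.
by apply/eqP; rewrite W2; ring.
Qed.

(** The Gram determinant identity for [N s], [T s] and [d], with [N s] and [T s] orthonormal; it
    avoids expanding [d] in the frame. *)
Lemma frame_norm s d : I s ->
  mink d d = mink (T s) d ^+ 2 + mink (N s) d ^+ 2 - mink (B s) d ^+ 2.
Proof. by move=> Is; rewrite BE// mink_lcross_sq TT// NN// NT//; ring. Qed.

Lemma slant_axis_necessary d c : I !=set0 ->
  (forall s, I s -> mink (B s) d = c) ->
  exists2 sigma, sigma ^+ 2 = mink d d + c ^+ 2 &
    forall s, I s -> c = - sigma * L s.
Proof.
move=> [s0 Is0] Bd.
pose a s := mink (T s) d; pose b s := mink (N s) d.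
have da s : I s -> is_derive s (1 : R) a (kg s * c - kn s * b s).
  move=> Is; apply: (is_derive_eq (is_derive_minkl d (dT Is))).
  by rewrite !mink_linear Bd.
have db s : I s -> is_derive s (1 : R) b (kn s * a s + tg s * c).
  move=> Is; apply: (is_derive_eq (is_derive_minkl d (dN Is))).
  by rewrite !mink_linear Bd.
have fagb s : I s -> f s * a s + g s * b s = 0.
  move=> Is.
  have := locally_constant_derive0 oI Bd Is (is_derive_minkl d (dB Is)).
  rewrite !mink_linear -/(a s) -/(b s) fE// gE// => h; apply: (mulfI (W0 Is)).
  by rewrite mulr0 -h; ring.
(* By [fagb], [(a, b)] is orthogonal to the unit vector [(f, g)], hence a multiple of [(- g, f)];
   [u] is the factor. *)
pose u s := f s * b s - g s * a s.
have bE s : I s -> b s = f s * u s.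
  move=> Is; transitivity ((f s ^+ 2 + g s ^+ 2) * b s);
    first by rewrite fg1 ?mul1r.
  by rewrite -[RHS]addr0 -(mulr0 (g s)) -(fagb s Is) /u; ring.
have aE s : I s -> a s = - g s * u s.
  move=> Is; transitivity ((f s ^+ 2 + g s ^+ 2) * a s);
    first by rewrite fg1 ?mul1r.
  by rewrite -[RHS]addr0 -(mulr0 (f s)) -(fagb s Is) /u; ring.
have u_const s : I s -> u s = u s0.
  move=> Is; apply: (derive0_constant iI _ Is Is0) => t It.
  apply: (is_derive_eq (is_deriveB (is_derive_mul (df It) (db _ It))
    (is_derive_mul (dg It) (da _ It)))).
  (* The derivative of [u] is this multiple of the relation [fagb]; its terms in [c] cancel because
     [f * tg = g * kg]. *)
  rewrite -[RHS](mulr0 (kn t - (W t * L t + kn t))) -(fagb t It).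
  by rewrite (fE It) (gE It); ring.
exists (u s0) => [|s Is].
  rewrite (frame_norm d Is0) Bd// subrK -/(a s0) -/(b s0) aE// bE//.
  by rewrite -[LHS]mul1r -(fg1 Is0); ring.
(* Differentiating [fagb] gives [W * (c + u * L) = 0], once [a] and [b] are written through [u]. *)
have /(locally_constant_derive0 oI fagb Is) := is_deriveD
  (is_derive_mul (df Is) (da _ Is)) (is_derive_mul (dg Is) (db _ Is)).
rewrite aE// bE// u_const// (fE Is) (gE Is) => h.
apply: (mulfI (W0 Is)); rewrite -[LHS]mulr1 -(fg1 Is); apply/eqP.
rewrite -subr_eq0 -[X in _ == X]h; apply/eqP.
(* Both terms receive the factor [f ^+ 2 + g ^+ 2], equal to 1, so that a polynomial identity
   remains. *)
transitivity (W s * c * (f s ^+ 2 + g s ^+ 2)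
  + W s * u s0 * L s * (f s ^+ 2 + g s ^+ 2)).
  by rewrite fg1//; ring.
by ring.
Qed.

Lemma slant_axis_sufficient sigma c : I !=set0 ->
  (forall s, I s -> c = - sigma * L s) ->
  exists2 d, mink d d = sigma ^+ 2 - c ^+ 2 &
    forall s, I s -> mink (B s) d = c.
Proof.
move=> [s0 Is0] cL.
(* The coefficients on [T] and [N] are the products with the axis forced in the necessary direction;
   that on [B] is [- c] because [B] has norm -1. *)
pose D s := - (sigma * g s) *: T s + (sigma * f s) *: N s - c *: B s.
have BT s : I s -> mink (B s) (T s) = 0.
  by move=> Is; rewrite BE// lcross_orthr.
have BN s : I s -> mink (B s) (N s) = 0.
  by move=> Is; rewrite BE// lcross_orthl.
have BB s : I s -> mink (B s) (B s) = -1.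
  by move=> Is; rewrite BE// lcross_lcross_norm NT// NN// TT//; ring.
have D_const s : I s -> D s = D s0.
  move=> Is; apply/rowP => i.
  suff dD t : I t -> is_derive t (1 : R) (fun t => D t 0 i) 0.
    exact: (derive0_constant iI dD Is Is0).
  move=> It.
  have dsg : is_derive t (1 : R) (fun t => - (sigma * g t)) _ :=
    is_deriveN (is_derive_mul (is_derive_cst sigma t 1) (dg It)).
  have dsf := is_derive_mul (is_derive_cst sigma t 1) (df It).
  have h : is_derive t (1 : R) (fun t => - (sigma * g t) * T t 0 i +
      (sigma * f t) * N t 0 i - c * B t 0 i) _ :=
    is_deriveB (is_deriveD
      (is_derive_mul dsg (is_derive_coord i (dT It)))
      (is_derive_mul dsf (is_derive_coord i (dN It))))
      (is_derive_mul (is_derive_cst c t 1) (is_derive_coord i (dB It))).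
  rewrite (_ : (fun t => _) = fun t => - (sigma * g t) * T t 0 i +
      (sigma * f t) * N t 0 i - c * B t 0 i); last first.
    by apply/funext => r; rewrite /D !mxE.
  apply: (is_derive_eq h).
  (* In the derivative, [T] and [N] have coefficients [- W * f * (sigma * L + c)] and
     [- W * g * (sigma * L + c)], and the two contributions to [B] cancel. *)
  rewrite !mxE (fE It) (gE It) /cst (cL _ It).
  by ring.
exists (D s0).
  rewrite (frame_norm _ Is0) /D !mink_linear !BT// !BN// !BB// !NN// !NT// TT//.
  rewrite !(minkC (T _)) !(minkC (N _) (B _)) BT// BN// NT//.
  transitivity (sigma ^+ 2 * (f s0 ^+ 2 + g s0 ^+ 2) - c ^+ 2); first by ring.
  by rewrite fg1// mulr1.
move=> s Is; rewrite -(D_const s)// /D !mink_linear BT// BN// BB//.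
by ring.
Qed.

End SlantAxis.

(** * Hyperbolic functions: nonvanishing, ranges, and the choice of sign *)

Section HyperbolicFacts.
Context {R : realType}.
Implicit Types x c : R.

Lemma cosh2Bsinh2 x : cosh x ^+ 2 - sinh x ^+ 2 = 1.
Proof.
rewrite /cosh /sinh expRN.
by field; exact: lt0r_neq0 (expR_gt0 x).
Qed.

Lemma cosh_gt0 x : 0 < cosh x.
Proof. by rewrite divr_gt0// addr_gt0 ?expR_gt0. Qed.

Lemma sinh_neq0 x : x != 0 -> sinh x != 0.
Proof.
move=> x0; rewrite mulf_neq0 ?invr_neq0// subr_eq0.
by apply: contra x0 => /eqP/expR_inj xN; apply/eqP; lra.
Qed.

(** The preimage is arsinh, [ln (c + r)] with [r ^+ 2 = c ^+ 2 + 1]; then [(c + r) * (r - c) = 1]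
    gives the other exponential. The case of cosh is analogous. *)
Lemma sinh_surj c : exists x, sinh x = c.
Proof.
pose r := Num.sqrt (c ^+ 2 + 1).
have r2 : r ^+ 2 = c ^+ 2 + 1 by rewrite sqr_sqrtr// addr_ge0 ?sqr_ge0.
have r0 : 0 <= r by exact: sqrtr_ge0.
have cr : 0 < c + r by nra.
exists (ln (c + r)); rewrite /sinh expRN lnK//.
have -> : (c + r)^-1 = r - c.
  apply: (mulfI (lt0r_neq0 cr)); rewrite divff ?lt0r_neq0//.
  by transitivity (r ^+ 2 - c ^+ 2); [rewrite r2 | ]; ring.
by field.
Qed.

Lemma cosh_surj c : 1 <= c -> exists x, cosh x = c.
Proof.
move=> c1; pose r := Num.sqrt (c ^+ 2 - 1).
have r2 : r ^+ 2 = c ^+ 2 - 1 by rewrite sqr_sqrtr//; nra.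
have r0 : 0 <= r by exact: sqrtr_ge0.
have cr : 0 < c + r by lra.
exists (ln (c + r)); rewrite /cosh expRN lnK//.
have -> : (c + r)^-1 = c - r.
  apply: (mulfI (lt0r_neq0 cr)); rewrite divff ?lt0r_neq0//.
  by transitivity (c ^+ 2 - r ^+ 2); [rewrite r2 | ]; ring.
by field.
Qed.

(** Source of the sign [b] in [lambda] and [rho]: only the square of [sigma] is determined by the
    axis. *)
Lemma sqr_eq_sign x c : x ^+ 2 = c ^+ 2 -> exists b : bool, x = (-1) ^+ b * c.
Proof.
move=> /eqP; rewrite eqf_sqr => /orP[]/eqP->.
  by exists false; rewrite mul1r.
by exists true; rewrite mulN1r.
Qed.

End HyperbolicFacts.

(** * The Darboux frame of a curve on a timelike surface, and its timelike and spacelike axes *)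

Section DarbouxSlantAxis.
Context {R : realType} (I : set R) (M : set 'rV[R]_3).
Context (gamma N : R -> 'rV[R]_3) (kg kn tg : R -> R).
Context (hI : open_interval I).
Context (hM : timelike_surface M).
Context (hgamma : unit_speed_spacelike_curve I gamma).
Context (hgammaM : forall s, I s -> M (gamma s)).
Context (hN : unit_normal_along I M gamma N).
Context (hD : darboux_curvatures I gamma N kg kn tg).
Context (hkg : forall s, I s -> kg s != 0).

Let T := gamma^`()%classic.
Let B := darbouxB gamma N.

Let spacelike_unit (v : 'rV[R]_3) :
  spacelike v -> unit_vector v -> mink v v = 1.
Proof.
move=> [v0|->] [//|]; first lra.
by rewrite /mink !mxE; lra.
Qed.

Let TT s : I s -> mink (T s) (T s) = 1.
Proof. by move=> /(hgamma.2) [] ; exact: spacelike_unit. Qed.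

Let NN s : I s -> mink (N s) (N s) = 1.
Proof.
move=> Is; have nN := hN.2 s Is.
by apply: spacelike_unit nN.1; exact: ((hM.2 _ (hgammaM Is)).2 _ nN).
Qed.

Let NT s : I s -> mink (N s) (T s) = 0.
Proof.
move=> Is; apply: (hN.2 s Is).2.
exact: tangent_velocity hI.1 hgamma.1 hgammaM Is.
Qed.

Let BT s : I s -> mink (B s) (T s) = 0.
Proof. by move=> Is; exact: lcross_orthr. Qed.

Let BN s : I s -> mink (B s) (N s) = 0.
Proof. by move=> Is; exact: lcross_orthl. Qed.

Let BB s : I s -> mink (B s) (B s) = -1.
Proof.
by move=> Is; rewrite /B /darbouxB lcross_lcross_norm NT// NN// TT//; ring.
Qed.

Let T_derivable s : I s -> derivable T s 1.
Proof. exact/smooth_derivable/smooth_derive1/hgamma.1. Qed.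

Let N_derivable s : I s -> derivable N s 1.
Proof. exact/smooth_derivable/hN.1. Qed.

Let B_derivable s : I s -> derivable B s 1.
Proof.
move=> Is.
by apply: derivable_lcross; [exact: N_derivable | exact: T_derivable].
Qed.

Let dT s : I s -> is_derive s (1 : R) T (kg s *: B s - kn s *: N s).
Proof.
move=> Is; split; first exact: T_derivable.
by have [+ _ _] := hD Is; rewrite derive1E.
Qed.

Let dB s : I s -> is_derive s (1 : R) B (kg s *: T s + tg s *: N s).
Proof.
move=> Is; split; first exact: B_derivable.
by have [_ + _] := hD Is; rewrite derive1E.
Qed.

Let dN s : I s -> is_derive s (1 : R) N (kn s *: T s + tg s *: B s).
Proof.
move=> Is; split; first exact: N_derivable.
by have [_ _] := hD Is; rewrite derive1E.
Qed.

Let derivable_eq_on (f g : R -> R) s : (forall t, I t -> f t = g t) -> I s ->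
  derivable f s 1 -> derivable g s 1.
Proof.
move=> fg Is; apply: near_eq_derivable.
near=> t; apply: fg; near: t; apply: open_nbhs_nbhs.
by split=> //; exact: hI.1.
Unshelve. all: by end_near. Qed.

(** [kg] is given only through the frame equations; as [B] has norm -1, it equals [- mink T' B] on
    [I] and inherits derivability from the frame. Likewise [tg] is [- mink N' B]. *)
Let kg_derivable s : I s -> derivable kg s 1.
Proof.
move=> Is; have sT := smooth_derive1 hgamma.1.
have /derivableP d2T := smooth_derivable (smooth_derive1 sT) Is.
have dBs := derivableP (B_derivable Is).
have [dm _] := is_deriveN (is_derive_mink d2T dBs).
apply: derivable_eq_on Is dm.
move=> t It; rewrite !fctE; have [-> _ _] := hD It.
by rewrite !mink_linear -/(B t) BB// (minkC (N t)) BN//; ring.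
Qed.

Let tg_derivable s : I s -> derivable tg s 1.
Proof.
move=> Is.
have /derivableP d2N := smooth_derivable (smooth_derive1 hN.1) Is.
have dBs := derivableP (B_derivable Is).
have [dm _] := is_deriveN (is_derive_mink d2N dBs).
apply: derivable_eq_on Is dm.
move=> t It; rewrite !fctE; have [_ _ ->] := hD It.
by rewrite !mink_linear -/(B t) -/(T t) BB// (minkC (T t)) BT//; ring.
Qed.

(** The causal character of the axis enters only through [eps], so the values -1 and 1 treat (i) and
    (ii) together. *)
Lemma slant_axisP (eps c : R) : I !=set0 ->
  (exists2 d, mink d d = eps & forall s, I s -> mink (B s) d = c) <->
  (exists2 sigma, sigma ^+ 2 = eps + c ^+ 2 &
    forall s, I s -> c = - sigma * slant_invariant kg kn tg s).
Proof.
move=> I0; split=> [[d <-]|[sigma sE]].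
  by apply: slant_axis_necessary => //; [exact: hI.1 | exact: hI.2].
rewrite (_ : eps = sigma ^+ 2 - c ^+ 2); last by rewrite sE addrK.
by apply: slant_axis_sufficient => //; exact: hI.2.
Qed.

(** With [eps = -1] and [c = - cosh delta], [sigma ^+ 2] is [sinh delta ^+ 2]; dividing
    [c = - sigma * L] by [sinh delta], nonzero here, gives coth. *)
Lemma timelike_axisP delta : delta != 0 ->
  (exists d, timelike_axis I gamma N d delta) <->
  (exists b, forall s, I s -> lambda kg kn tg b s = coth delta).
Proof.
move=> delta0; have sh0 := sinh_neq0 delta0; have cs := cosh2Bsinh2 delta.
have [->|/set0P I0] := eqVneq I set0.
  split=> _; first by exists false.
  (* On an empty [I] the angle condition is vacuous, but a timelike unit vector must still be
     exhibited. *)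
  exists (\row_(i < 3) [:: 1; 0; 0]`_i).
  by split=> //; rewrite /unit_vector /timelike /mink !mxE/=; [right|]; lra.
split=> [[d [ud td Bd]]|[b bE]].
  have ed : mink d d = -1 by case: ud td => // ud; rewrite /timelike ud; lra.
  have /slant_axisP[//|sigma sE cE] : exists2 d, mink d d = -1 &
      forall s, I s -> mink (B s) d = - cosh delta.
    by exists d => // s /Bd[].
  have [|b sb] := @sqr_eq_sign _ sigma (sinh delta); first by rewrite sE; nra.
  exists b => s /cE; rewrite sb /lambda /coth => h; apply: (mulIf sh0).
  by rewrite divfK// -[RHS]opprK h; ring.
have [_] := slant_axisP (-1) (- cosh delta) I0.
case=> [|d ed Bd].
  exists ((-1) ^+ b * sinh delta).
    by rewrite exprMn sqrr_sign mul1r; nra.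
  move=> s /bE; rewrite /lambda /coth => h.
  rewrite -[cosh delta](divfK sh0) -h; ring.
exists d; split=> [||s Is]; rewrite ?/timelike ?ed; [by right|lra|].
by rewrite /same_timecone Bd// oppr_lt0 cosh_gt0.
Qed.

(** Here [sigma ^+ 2] is [1 + sinh zeta ^+ 2 = cosh zeta ^+ 2]. Now [c = sinh zeta] has no minus
    sign to cancel that of [- sigma * L], whence the opposite sign in [rho]. *)
Lemma spacelike_axisP zeta :
  (exists d, spacelike_axis I gamma N d zeta) <->
  (exists b, forall s, I s -> rho kg kn tg b s = tanh zeta).
Proof.
have ch0 := lt0r_neq0 (cosh_gt0 zeta); have cs := cosh2Bsinh2 zeta.
have [->|/set0P I0] := eqVneq I set0.
  split=> _; first by exists false.
  exists (\row_(i < 3) [:: 0; 1; 0]`_i).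
  by split=> //; left; rewrite /mink !mxE/=; lra.
split=> [[d [ud sd Bd]]|[b bE]].
  have /slant_axisP[//|sigma sE cE] : exists2 d, mink d d = 1 &
      forall s, I s -> mink (B s) d = sinh zeta.
    by exists d => //; exact: spacelike_unit.
  have [|b sb] := @sqr_eq_sign _ sigma (cosh zeta); first by rewrite sE; nra.
  exists b => s /cE; rewrite sb /rho /tanh => h; apply: (mulIf ch0).
  by rewrite divfK// h; ring.
have [_] := slant_axisP 1 (sinh zeta) I0.
case=> [|d ed Bd].
  exists ((-1) ^+ b * cosh zeta).
    by rewrite exprMn sqrr_sign mul1r; nra.
  move=> s /bE; rewrite /rho /tanh => h.
  rewrite -[LHS](divfK ch0) -h; ring.
by exists d; split=> //; left; rewrite ed// ltr01.
Qed.

(** The point is to write the constant product as a hyperbolic function of an angle: for a spacelike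
    axis every real is a sinh, while a timelike axis needs an absolute value above 1 and the right
    time-cone. *)
Lemma helix_axisP : relatively_normal_slant_helix I gamma N <->
  (exists2 delta, delta != 0 & exists d, timelike_axis I gamma N d delta) \/
  (exists zeta d, spacelike_axis I gamma N d zeta).
Proof.
split=> [[d ud [c Bd]]|]; last first.
  case=> [[delta _ [d [ud _ Bd]]]|[zeta [d [ud _ Bd]]]]; exists d => //.
    by exists (- cosh delta) => s /Bd[].
  by exists (sinh zeta).
have [I0|/set0P I0] := eqVneq I set0.
  (* With [I] empty, any nonzero angle serves. *)
  left; exists 1; first exact: oner_neq0.
  by apply/timelike_axisP; [exact: oner_neq0 | exists false; rewrite I0].
case: ud => ed.
  right; have [zeta zc] := sinh_surj c; exists zeta, d; split.
  - by left.
  - by left; rewrite ed.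
  - by rewrite zc.
have /slant_axisP[//|sigma sE cE] : exists2 d, mink d d = -1 &
    forall s, I s -> mink (B s) d = c by exists d.
have [s0 Is0] := I0.
(* If [sigma] were 0, then [c = - sigma * L] would be 0, against [sigma ^+ 2 = -1 + c ^+ 2]. The
   strict inequality is what makes [delta] nonzero. *)
have c1 : 1 < `|c|.
  have sigma0 : sigma != 0.
    by apply/eqP => s_eq0; move: sE; rewrite (cE _ Is0) s_eq0 oppr0 mul0r; lra.
  have : 0 < sigma ^+ 2 by rewrite exprn_even_gt0.
  rewrite sE -real_normK ?num_real//; have := normr_ge0 c; nra.
have [delta dc] := cosh_surj (ltW c1).
left; exists delta.
  apply/eqP => delta0; move: c1; rewrite -dc delta0 /cosh oppr0 expR0; lra.
(* The axis is reversed if necessary so that its product with [B] is negative, which puts it in the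
   time-cone of [B]. *)
exists (- Num.sg c *: d).
have eNd : mink (- Num.sg c *: d) (- Num.sg c *: d) = -1.
  have c0 : c != 0 by rewrite -normr_gt0; lra.
  by rewrite !mink_linear ed mulrA mulrNN -expr2 sqr_sg c0 mul1r.
split=> [||s Is]; rewrite ?/timelike ?eNd; [by right|lra|].
have BE : mink (B s) (- Num.sg c *: d) = - cosh delta.
  by rewrite mink_linear Bd// dc mulNr -normrEsg.
by rewrite /same_timecone BE oppr_lt0 cosh_gt0.
Qed.

End DarbouxSlantAxis.

Theorem theorem6p2 (R : realType) (I : set R) (M : set 'rV[R]_3)
    (gamma N : R -> 'rV[R]_3) (kg kn tg kappa : R -> R) (n : R -> 'rV[R]_3)
    (hI : open_interval I)
    (hM : timelike_surface M)
    (hgamma : unit_speed_spacelike_curve I gamma)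
    (hgammaM : forall s, I s -> M (gamma s))
    (hN : unit_normal_along I M gamma N)
    (hD : darboux_curvatures I gamma N kg kn tg)
    (hn : spacelike_principal_normal I gamma kappa n)
    (hkg : forall s, I s -> kg s != 0) :
  [/\ relatively_normal_slant_helix I gamma N <->
        ((exists (b : bool) (delta : R), delta != 0 /\
            forall s, I s -> lambda kg kn tg b s = coth delta) \/
         (exists (b : bool) (zeta : R),
            forall s, I s -> rho kg kn tg b s = tanh zeta)),
      forall delta : R, delta != 0 ->
        ((exists d : 'rV[R]_3, timelike_axis I gamma N d delta) <->
         (exists b : bool, forall s, I s -> lambda kg kn tg b s = coth delta)) &
      forall zeta : R,
        ((exists d : 'rV[R]_3, spacelike_axis I gamma N d zeta) <->
         (exists b : bool, forall s, I s -> rho kg kn tg b s = tanh zeta))].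
Proof.
have tP := timelike_axisP hI hM hgamma hgammaM hN hD hkg.
have sP := spacelike_axisP hI hM hgamma hgammaM hN hD hkg.
split=> //.
rewrite (helix_axisP hI hM hgamma hgammaM hN hD hkg).
split=> [[[delta d0 /(tP _ d0)[b bE]]|[zeta /sP[b bE]]]|
        [[b [delta [d0 bE]]]|[b [zeta bE]]]].
- by left; exists b, delta.
- by right; exists b, zeta.
- by left; exists delta => //; apply/tP => //; exists b.
- by right; exists zeta; apply/sP; exists b.
Qed.
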